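(* Let $N\ge1$, let $n\ge m$ be positive integers and $\kappa>0$. Let $\{(U_j,V_j)\}_{j=1}^N$ be a solution of the homogeneous double special orthogonal matrix model $$\dot U_j=\frac{\kappa}{N}\sum_{k=1}^N\langle V_j,V_k\rangle_F\,(U_k-U_jU_k^\top U_j),\qquad \dot V_j=\frac{\kappa}{N}\sum_{k=1}^N\langle U_j,U_k\rangle_F\,(V_k-V_jV_k^\top V_j),$$ with $(U_j,V_j)(0)=(U_j^0,V_j^0)\in\mathbf{SO}(n)\times\mathbf{SO}(m)$. Suppose $$\mathcal L(0)<\alpha_{m,n}:=\frac{-(12n+27)+\sqrt{(12n+27)^2+24m(3n+4)}}{4(4n+3)}.$$ Then $\lim_{t\to\infty}\mathcal L(t)=0$.
   Context: For real matrices, $\langle A,B\rangle_F=\mathrm{tr}(A^\top B)$ and $\|A\|_F=\sqrt{\langle A,A\rangle_F}$. $\mathbf{SO}(n)$ is the special orthogonal group. For a solution, set $d_{ij}=\langle U_i,U_j\rangle_F$, $c_{ij}=\langle V_i,V_j\rangle_F$, $\mathcal D(\mathcal U)=\max_{i,j}\|U_i-U_j\|_F$, $\mathcal D(\mathcal V)=\max_{i,j}\|V_i-V_j\|_F$, $\mathcal S(\mathcal U)=\max_{i,j}|n-d_{ij}|$, $\mathcal S(\mathcal V)=\max_{i,j}|m-c_{ij}|$, and $\mathcal L=\mathcal D(\mathcal U)+\mathcal D(\mathcal V)+\mathcal S(\mathcal U)+\mathcal S(\mathcal V)$. *)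

(* Defs.v *)
From HB Require Import structures.
From mathcomp Require Import all_boot all_order all_algebra.
From mathcomp Require Import all_classical all_reals all_analysis.
Set Implicit Arguments. Unset Strict Implicit. Unset Printing Implicit Defensive.
Import Order.TTheory GRing.Theory Num.Theory.
Import numFieldNormedType.Exports.
Local Open Scope classical_set_scope.
Local Open Scope ring_scope.

Definition frob_inner (R : realType) (p q : nat) (A B : 'M[R]_(p, q)) : R :=
  \tr (A^T *m B).
Definition frob_norm (R : realType) (p q : nat) (A : 'M[R]_(p, q)) : R :=
  Num.sqrt (frob_inner A A).

Definition is_SO (R : realType) (n : nat) (A : 'M[R]_n) : Prop :=
  A^T *m A = 1%:M /\ \det A = 1.

Definition dsom_rhs (R : realType) (N n m : nat) (kappa : R)
  (U : 'I_N -> 'M[R]_n) (V : 'I_N -> 'M[R]_m) (j : 'I_N) : 'M[R]_n :=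
  (kappa / N%:R) *: \sum_(k < N) (frob_inner (V j) (V k) *: (U k - U j *m (U k)^T *m U j)).

Definition is_dsom_solution (R : realType) (N n m : nat) (kappa : R)
  (U : 'I_N -> R -> 'M[R]_n) (V : 'I_N -> R -> 'M[R]_m) : Prop :=
  (forall (j : 'I_N) (t : R), 0 < t ->
     is_derive t 1 (U j) (dsom_rhs kappa (fun k => U k t) (fun k => V k t) j) /\
     is_derive t 1 (V j) (dsom_rhs kappa (fun k => V k t) (fun k => U k t) j)) /\
  (forall j : 'I_N, (U j s @[s --> 0^'+] --> U j 0) /\ (V j s @[s --> 0^'+] --> V j 0)).

Definition diam (R : realType) (N p : nat) (W : 'I_N -> 'M[R]_p) : R :=
  \big[Num.max/0]_(i < N) \big[Num.max/0]_(j < N) frob_norm (W i - W j).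
Definition devS (R : realType) (N p : nat) (W : 'I_N -> 'M[R]_p) : R :=
  \big[Num.max/0]_(i < N) \big[Num.max/0]_(j < N) `|p%:R - frob_inner (W i) (W j)|.
Definition dsomL (R : realType) (N n m : nat)
  (U : 'I_N -> R -> 'M[R]_n) (V : 'I_N -> R -> 'M[R]_m) (t : R) : R :=
  diam (fun k => U k t) + diam (fun k => V k t)
  + devS (fun k => U k t) + devS (fun k => V k t).

Definition alpha_mn (R : realType) (n m : nat) : R :=
  (- (12 * n%:R + 27) + Num.sqrt ((12 * n%:R + 27) ^+ 2 + 24 * m%:R * (3 * n%:R + 4)))
  / (4 * (4 * n%:R + 3)).

(* Main.v *)
Require Import Defs.
From HB Require Import structures.
From mathcomp Require Import all_boot all_order all_algebra.
From mathcomp Require Import all_classical all_reals all_analysis.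
From mathcomp Require Import ring lra.
Set Implicit Arguments. Unset Strict Implicit. Unset Printing Implicit Defensive.
Import Order.TTheory GRing.Theory Num.Theory.
Import numFieldNormedType.Exports.
Local Open Scope classical_set_scope.
Local Open Scope ring_scope.

(** The flow preserves orthogonality, so squared distances are
    [|U_i - U_j|^2 = 2 (n - d_ij)], and likewise for [V].  The hypothesis on
    [L(0)] is used only through [alpha_{m,n} <= 1/4]: all these squared distances
    are initially below [1/16].  They then stay below [rho(t) = exp(-kappa t)/16].
    Indeed, consider the first time one of them, say [|U_i - U_j|^2], reaches
    [rho = x^2], and put [a = U_i^T U_k - 1], [b = U_i^T U_j - 1].  If all weights
    were [m], the contribution of [U_k] to the growth of [d_ij] would be [kappa m / N] times
      [2 |b|^2 + <a, a b> + <b, b b> - <a, b b> >= 2 x^2 - 3 x^3],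
    and replacing [m] by the true weights, which differ from it by at most
    [x^2 / 2], costs at most [2 x^4].  Hence [|U_i - U_j|^2] decreases at rate at
    least [2 kappa x^2], faster than [rho], which is impossible at a first
    crossing. *)

(** * Inequalities for the Frobenius inner product and for orthogonal matrices *)

Section FrobeniusInner.
Variable R : realType.

Lemma frob_innerE (p q : nat) (A B : 'M[R]_(p, q)) :
  frob_inner A B = \sum_i \sum_j A i j * B i j.
Proof.
rewrite /frob_inner /mxtrace exchange_big; apply: eq_bigr => j _.
by rewrite mxE; apply: eq_bigr => i _; rewrite mxE.
Qed.

Lemma frob_innerC (p q : nat) (A B : 'M[R]_(p, q)) :
  frob_inner A B = frob_inner B A.
Proof. by rewrite /frob_inner -mxtrace_tr trmx_mul trmxK. Qed.

Lemma frob_innerDl (p q : nat) (A B C : 'M[R]_(p, q)) :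
  frob_inner (A + B) C = frob_inner A C + frob_inner B C.
Proof. by rewrite /frob_inner linearD mulmxDl linearD. Qed.

Lemma frob_innerDr (p q : nat) (A B C : 'M[R]_(p, q)) :
  frob_inner C (A + B) = frob_inner C A + frob_inner C B.
Proof. by rewrite /frob_inner mulmxDr linearD. Qed.

Lemma frob_innerZl (p q : nat) (k : R) (A B : 'M[R]_(p, q)) :
  frob_inner (k *: A) B = k * frob_inner A B.
Proof. by rewrite /frob_inner linearZ -scalemxAl linearZ. Qed.

Lemma frob_innerZr (p q : nat) (k : R) (A B : 'M[R]_(p, q)) :
  frob_inner A (k *: B) = k * frob_inner A B.
Proof. by rewrite /frob_inner -scalemxAr linearZ. Qed.

Lemma frob_innerNl (p q : nat) (A B : 'M[R]_(p, q)) :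
  frob_inner (- A) B = - frob_inner A B.
Proof. by rewrite -scaleN1r frob_innerZl mulN1r. Qed.

Lemma frob_innerNr (p q : nat) (A B : 'M[R]_(p, q)) :
  frob_inner A (- B) = - frob_inner A B.
Proof. by rewrite -scaleN1r frob_innerZr mulN1r. Qed.

Lemma frob_inner_suml (p q N : nat) (F : 'I_N -> 'M[R]_(p, q)) B :
  frob_inner (\sum_k F k) B = \sum_k frob_inner (F k) B.
Proof. by rewrite /frob_inner linear_sum mulmx_suml linear_sum. Qed.

Lemma frob_inner_ge0 (p q : nat) (A : 'M[R]_(p, q)) : 0 <= frob_inner A A.
Proof.
rewrite frob_innerE; apply: sumr_ge0 => i _; apply: sumr_ge0 => j _.
by rewrite -expr2 sqr_ge0.
Qed.

Lemma frob_inner_eq0 (p q : nat) (A : 'M[R]_(p, q)) :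
  frob_inner A A = 0 -> A = 0.
Proof.
rewrite frob_innerE => /eqP; rewrite psumr_eq0; last first.
  by move=> i _; apply: sumr_ge0 => j _; rewrite -expr2 sqr_ge0.
move=> /allP h; apply/matrixP => i j; rewrite mxE.
have := h i (mem_index_enum _); rewrite psumr_eq0; last first.
  by move=> k _; rewrite -expr2 sqr_ge0.
move=> /allP/(_ j (mem_index_enum _)).
by rewrite /= mulf_eq0 orbb => /eqP.
Qed.

Lemma frob_cauchy_schwarz (p q : nat) (A B : 'M[R]_(p, q)) :
  frob_inner A B ^+ 2 <= frob_inner A A * frob_inner B B.
Proof.
have [/frob_inner_eq0 ->|B0] := eqVneq (frob_inner B B) 0.
  by rewrite -(scale0r (0 : 'M[R]_(p, q))) !frob_innerZr !mul0r mulr0 expr0n.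
have Bgt0 : 0 < frob_inner B B by rewrite lt_def B0 frob_inner_ge0.
have := frob_inner_ge0 (frob_inner B B *: A - frob_inner A B *: B).
rewrite !(frob_innerDl, frob_innerDr, frob_innerNl, frob_innerNr).
rewrite !(frob_innerZl, frob_innerZr) (frob_innerC B A) => h.
by rewrite -subr_ge0 -(pmulr_rge0 _ Bgt0); apply: le_trans h _; lra.
Qed.

(** Each entry of [A *m B] pairs a row of [A] with a column of [B]; Cauchy-Schwarz on every entry is
    then summed. *)
Lemma frob_inner_mulmx_le (p q r : nat) (A : 'M[R]_(p, q)) (B : 'M[R]_(q, r)) :
  frob_inner (A *m B) (A *m B) <= frob_inner A A * frob_inner B B.
Proof.
have -> : frob_inner B B = \sum_j (B^T *m B) j j by [].
rewrite (frob_innerE (A *m B)) (frob_innerE A).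
rewrite big_distrlr; apply: ler_sum => i _; apply: ler_sum => j _ /=.
have := frob_cauchy_schwarz (row i A)^T (col j B).
have -> : frob_inner (row i A)^T (col j B) = (A *m B) i j.
  rewrite frob_innerE mxE; apply: eq_bigr => k _.
  by rewrite big_ord1 !mxE.
have -> : frob_inner (row i A)^T (row i A)^T = \sum_k A i k * A i k.
  by rewrite frob_innerE; apply: eq_bigr => k _; rewrite big_ord1 !mxE.
have -> : frob_inner (col j B) (col j B) = (B^T *m B) j j.
  by rewrite frob_innerE mxE; apply: eq_bigr => k _; rewrite big_ord1 !mxE.
by rewrite expr2.
Qed.

Lemma frob_inner_bound (p q : nat) (x y : R) (A B : 'M[R]_(p, q)) :
  0 <= x -> 0 <= y -> frob_inner A A <= x ^+ 2 -> frob_inner B B <= y ^+ 2 ->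
  `|frob_inner A B| <= x * y.
Proof.
move=> x0 y0 hA hB.
rewrite -(ger0_norm (mulr_ge0 x0 y0)) -ler_sqr ?nnegrE// !real_normK ?num_real//.
rewrite exprMn; apply: le_trans (frob_cauchy_schwarz A B) _.
by apply: ler_pM => //; exact: frob_inner_ge0.
Qed.

Lemma frob_inner_mul_bound (n : nat) (x : R) (A B C : 'M[R]_n) :
  0 <= x -> frob_inner A A <= x ^+ 2 -> frob_inner B B <= x ^+ 2 ->
  frob_inner C C <= x ^+ 2 -> `|frob_inner A (B *m C)| <= x ^+ 3.
Proof.
move=> x0 hA hB hC; rewrite exprS.
apply: frob_inner_bound => //; first exact: sqr_ge0.
apply: le_trans (frob_inner_mulmx_le B C) _.
by rewrite [leRHS]expr2; apply: ler_pM => //; exact: frob_inner_ge0.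
Qed.

Lemma frob_inner_tr (p q : nat) (A B : 'M[R]_(p, q)) :
  frob_inner A^T B^T = frob_inner A B.
Proof. by rewrite frob_innerC /frob_inner trmxK mxtrace_mulC. Qed.

Lemma frob_inner_mulmxl (p q r : nat) (A : 'M[R]_(p, q)) (B : 'M[R]_(q, r)) C :
  frob_inner (A *m B) C = frob_inner B (A^T *m C).
Proof. by rewrite /frob_inner trmx_mul mulmxA. Qed.

Lemma frob_inner_orthoM (p q : nat) (O : 'M[R]_p) (A B : 'M[R]_(p, q)) :
  O^T *m O = 1%:M -> frob_inner (O *m A) (O *m B) = frob_inner A B.
Proof. by move=> hO; rewrite frob_inner_mulmxl mulmxA hO mul1mx. Qed.

Lemma frob_inner_ortho (p : nat) (O : 'M[R]_p) :
  O^T *m O = 1%:M -> frob_inner O O = p%:R.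
Proof. by rewrite /frob_inner => ->; rewrite mxtrace1. Qed.

Lemma frob_dist_ortho (p : nat) (X Y : 'M[R]_p) :
  X^T *m X = 1%:M -> Y^T *m Y = 1%:M ->
  frob_inner (X - Y) (X - Y) = 2 * (p%:R - frob_inner X Y).
Proof.
move=> hX hY; rewrite !(frob_innerDl, frob_innerDr, frob_innerNl, frob_innerNr).
by rewrite (frob_inner_ortho hX) (frob_inner_ortho hY) (frob_innerC Y X); ring.
Qed.

(** With [a = A - 1], expand [(1 + a)^T (1 + a) = 1]: the symmetric part of [a] is of second
    order. *)
Lemma orthogonal_displacement (p : nat) (A : 'M[R]_p) :
  A^T *m A = 1%:M ->
  (A - 1%:M) + (A - 1%:M)^T = - ((A - 1%:M)^T *m (A - 1%:M)).
Proof.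
move=> hA; rewrite linearB /= trmx1 mulmxBl !mulmxBr hA !mulmx1 !mul1mx.
by apply/matrixP => i j; rewrite !mxE; ring.
Qed.

End FrobeniusInner.

(** * The pull of a third orthogonal matrix on a pair *)

Section PairInteraction.
Variables (R : realType) (p : nat).
Implicit Types X Y Z A B : 'M[R]_p.

(** Up to its weight, what [Z] contributes to the derivative of [<X, Y>] through the motion of
    [X]. *)
Definition alignment X Y Z : R := frob_inner (Z - X *m Z^T *m X) Y.

(** Take [A = X^T Z]: left multiplication by [X] is an isometry, so [X] can be moved to the
    identity. *)
Lemma relative_frame X Z : X^T *m X = 1%:M -> Z^T *m Z = 1%:M ->
  exists A, [/\ Z = X *m A, A^T *m A = 1%:M &
    frob_inner (A - 1%:M) (A - 1%:M) = frob_inner (X - Z) (X - Z)].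
Proof.
move=> hX hZ; have hX' : X *m X^T = 1%:M by apply: mulmx1C.
exists (X^T *m Z); split; first by rewrite mulmxA hX' mul1mx.
  by rewrite trmx_mul trmxK -mulmxA (mulmxA X) hX' mul1mx.
rewrite -(frob_inner_orthoM _ _ hX) mulmxBr mulmxA hX' mul1mx mulmx1.
by rewrite -[Z - X]opprB frob_innerNl frob_innerNr opprK.
Qed.

Lemma alignment_frame X A B : X^T *m X = 1%:M ->
  alignment X (X *m B) (X *m A) = frob_inner (A - A^T) B.
Proof.
move=> hX; rewrite /alignment trmx_mul -!mulmxA hX mulmx1 -mulmxBr.
exact: frob_inner_orthoM.
Qed.

Lemma alignment_frame_rev X A B : X^T *m X = 1%:M ->
  alignment (X *m B) X (X *m A) = \tr A - \tr (A^T *m (B *m B)).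
Proof.
move=> hX; rewrite /alignment trmx_mul -!mulmxA (mulmxA X^T) hX mul1mx -mulmxBr.
rewrite -[X in frob_inner _ X]mulmx1 frob_inner_orthoM // frob_innerC /frob_inner.
by rewrite trmx1 mul1mx raddfB /= (mxtrace_mulC B) mulmxA.
Qed.

Lemma alignment_bound X Y Z (x : R) :
  X^T *m X = 1%:M -> Y^T *m Y = 1%:M -> Z^T *m Z = 1%:M -> 0 <= x ->
  frob_inner (X - Y) (X - Y) <= x ^+ 2 ->
  frob_inner (X - Z) (X - Z) <= x ^+ 2 ->
  `|alignment X Y Z| <= 2 * x ^+ 2.
Proof.
move=> hX hY hZ x0 hXY hXZ.
have [B [eY hB eB]] := relative_frame hX hY.
have [A [eZ hA eA]] := relative_frame hX hZ.
rewrite -eB in hXY; rewrite -eA in hXZ.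
rewrite eY eZ alignment_frame //.
(* The antisymmetric [A - A^T] is orthogonal to [1], so [B] may be replaced by [B - 1]. Both factors
   are then of size [x], whence a quadratic bound. *)
have -> : frob_inner (A - A^T) B =
    frob_inner (A - 1%:M) (B - 1%:M) - frob_inner (A - 1%:M)^T (B - 1%:M).
  rewrite -frob_innerNl -frob_innerDl linearB /= trmx1 opprB addrA subrK.
  have tr0 : frob_inner (A - A^T) 1%:M = 0.
    by rewrite frob_innerC /frob_inner trmx1 mul1mx raddfB /= mxtrace_tr subrr.
  by rewrite frob_innerDr frob_innerNr tr0 subr0.
apply: le_trans (ler_normB _ _) _.
rewrite mulr2n mulrDl !mul1r; apply: lerD; rewrite [leRHS]expr2;
  by apply: frob_inner_bound => //; rewrite frob_inner_tr.
Qed.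

(** The left side is [- tr ((A + A^T B) b)]. The displacement relations turn its terms [tr b] and
    [tr (b b)] into [- |b|^2] multiples plus cubic terms, which isolates the coercive part
    [2 |b|^2]. *)
Lemma alignment_sum_identity A B :
  A^T *m A = 1%:M -> B^T *m B = 1%:M ->
  let a := A - 1%:M in let b := B - 1%:M in
  frob_inner (A - A^T) B + (\tr A - \tr (A^T *m (B *m B))) =
  2 * frob_inner b b + frob_inner a (a *m b) + frob_inner b (b *m b)
  - frob_inner a (b *m b).
Proof.
move=> hA hB a b.
have ea := orthogonal_displacement hA; have eb := orthogonal_displacement hB.
rewrite -/a -/b in ea eb.
have -> : frob_inner (A - A^T) B + (\tr A - \tr (A^T *m (B *m B))) =
    - \tr ((A + A^T *m B) *m b).
  rewrite /frob_inner /b linearB /= trmxK mulmxBl linearB /= mulmxBr mulmx1.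
  by rewrite linearB /= mulmxDl !linearD /= !mulmxA; ring.
(* Expanding gives [2 + a + a^T + b + a^T b], where [a + a^T = - a^T a]. *)
have -> : A + A^T *m B = 1%:M + 1%:M - a^T *m a + b + a^T *m b.
  rewrite -ea /a /b linearB /= trmx1 mulmxBl mulmxBr mulmx1 mul1mx.
  by apply/matrixP => i j; rewrite !mxE; ring.
clearbody a b; rewrite !mulmxDl mulNmx !linearD /= linearN /= !mul1mx.
have trb : \tr b + \tr b = - frob_inner b b.
  by rewrite -{2}mxtrace_tr -linearD /= eb linearN.
(* Only one of the two factors is replaced, by [- b^T - b^T b]. *)
have trbb : \tr (b *m b) = - frob_inner b b - frob_inner b (b *m b).
  have {1}-> : b = - b^T - b^T *m b by rewrite -eb addrC addrK.
  by rewrite mulmxBl mulNmx linearB /= linearN /= /frob_inner !mulmxA.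
rewrite trbb.
have -> : \tr (a^T *m a *m b) = frob_inner a (a *m b) by rewrite /frob_inner mulmxA.
have -> : \tr (a^T *m b *m b) = frob_inner a (b *m b) by rewrite /frob_inner mulmxA.
lra.
Qed.

(** In the identity [|b| = x], and each of the three cubic terms is at least [- x^3]. *)
Lemma alignment_sum_lower X Y Z (x : R) :
  X^T *m X = 1%:M -> Y^T *m Y = 1%:M -> Z^T *m Z = 1%:M -> 0 <= x ->
  frob_inner (X - Y) (X - Y) = x ^+ 2 ->
  frob_inner (X - Z) (X - Z) <= x ^+ 2 ->
  2 * x ^+ 2 - 3 * x ^+ 3 <= alignment X Y Z + alignment Y X Z.
Proof.
move=> hX hY hZ x0 hXY hXZ.
have [B [eY hB eB]] := relative_frame hX hY.
have [A [eZ hA eA]] := relative_frame hX hZ.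
rewrite -eB in hXY; rewrite -eA in hXZ.
rewrite eY eZ alignment_frame // alignment_frame_rev // alignment_sum_identity //= hXY.
have hb : frob_inner (B - 1%:M) (B - 1%:M) <= x ^+ 2 by rewrite hXY.
have := frob_inner_mul_bound x0 hXZ hXZ hb.
have := frob_inner_mul_bound x0 hb hb hb.
have := frob_inner_mul_bound x0 hXZ hb hb.
rewrite !ler_norml => /andP[_ h1] /andP[h2 _] /andP[h3 _].
lra.
Qed.

(* The weights [cX = <X', Z'>] and [cY = <Y', Z'>] come from the other factor:
   they equal [m] minus half a squared distance, so are close to [m]. *)
Lemma weighted_alignment_lower X Y Z (x m cX cY : R) :
  X^T *m X = 1%:M -> Y^T *m Y = 1%:M -> Z^T *m Z = 1%:M ->
  0 <= x -> x <= 1 / 4 -> 1 <= m ->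
  frob_inner (X - Y) (X - Y) = x ^+ 2 ->
  frob_inner (X - Z) (X - Z) <= x ^+ 2 ->
  frob_inner (Y - Z) (Y - Z) <= x ^+ 2 ->
  0 <= 2 * (m - cX) <= x ^+ 2 -> 0 <= 2 * (m - cY) <= x ^+ 2 ->
  x ^+ 2 <= cX * alignment X Y Z + cY * alignment Y X Z.
Proof.
move=> hX hY hZ x0 x4 m1 hXY hXZ hYZ /andP[gX0 gX] /andP[gY0 gY].
have hXY' : frob_inner (X - Y) (X - Y) <= x ^+ 2 by rewrite hXY.
have hYX : frob_inner (Y - X) (Y - X) <= x ^+ 2.
  by rewrite -[Y - X]opprB frob_innerNl frob_innerNr opprK.
have low := alignment_sum_lower hX hY hZ x0 hXY hXZ.
have := alignment_bound hX hY hZ x0 hXY' hXZ.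
have := alignment_bound hY hX hZ x0 hYX hYZ.
move: (alignment X Y Z) (alignment Y X Z) low => T1 T2 low hT2 hT1.
(* Replacing the weight [c] by [m] costs at most [(x^2 / 2) (2 x^2) = x^4], and [x^2 <= 1/16]. *)
have defect (c T : R) : 0 <= 2 * (m - c) -> 2 * (m - c) <= x ^+ 2 ->
    `|T| <= 2 * x ^+ 2 -> m * T - x ^+ 2 / 16 <= c * T.
  move=> c0 c1; rewrite ler_norml => /andP[_ hT].
  have x2 : x ^+ 2 <= 1 / 16 by rewrite expr2; nra.
  have x2' : 0 <= x ^+ 2 by exact: sqr_ge0.
  suff : (m - c) * T <= x ^+ 2 / 16 by lra.
  apply: (@le_trans _ _ ((m - c) * (2 * x ^+ 2))).
    by apply: ler_wpM2l => //; lra.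
  suff : 2 * (m - c) * x ^+ 2 <= x ^+ 2 / 16 by lra.
  by rewrite mulrC; apply: ler_wpM2l => //; lra.
have d1 := defect _ _ gX0 gX hT1; have d2 := defect _ _ gY0 gY hT2.
have x2 : 0 <= x ^+ 2 := sqr_ge0 x.
have x3 : 3 * x ^+ 3 <= 3 / 4 * x ^+ 2 by rewrite exprSr; nra.
(* Here [5/4 = 2 - 3/4]; the two weight defects remove [1/8], and [9/8] still exceeds [1]. *)
have : x ^+ 2 * (5 / 4) <= m * (T1 + T2).
  apply: (@le_trans _ _ (T1 + T2)); first lra.
  by rewrite ler_peMl //; lra.
lra.
Qed.

End PairInteraction.

(** * First crossings, a Gronwall lemma, and entrywise calculus of matrix curves *)

Section Calculus.
Variable R : realType.

(* At the first time some [phi i] vanishes its derivative is negative, so it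
   was positive just before. *)
Lemma barrier (I : finType) (phi : I -> R -> R) :
  (forall i, continuous (phi i)) -> (forall i, phi i 0 < 0) ->
  (forall i t, 0 < t -> (forall j, phi j t <= 0) -> phi i t = 0 ->
     exists2 d, d < 0 & is_derive t 1 (phi i) d) ->
  forall t, 0 <= t -> forall i, phi i t < 0.
Proof.
move=> cphi phi0 dphi t0 t0_ge0 i0.
case: ltP => // phit0; exfalso.
pose B := [set t : R | 0 <= t /\ exists i, 0 <= phi i t].
have B0 : B !=set0 by exists t0; split => //; exists i0.
have lbB : lbound B 0 by move=> t [].
have hB : has_inf B by split => //; exists 0.
pose tau := inf B.
have tau_ge0 : 0 <= tau by apply: lb_le_inf.
have before s : 0 <= s -> s < tau -> forall i, phi i s < 0.
  move=> s0 st i; rewrite ltNge; apply/negP => phis.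
  have : tau <= s by apply: ge_inf; [exists 0 | split => //; exists i].
  by rewrite leNgt st.
(* Otherwise, the index type being finite, all [phi i] stay negative on a common neighbourhood of
   [tau], although points of [B] lie arbitrarily close to its infimum. *)
have [i1 phi1] : exists i, 0 <= phi i tau.
  apply: contrapT => /forallNP hN.
  have near_neg : \forall s \near tau, forall i, phi i s < 0.
    apply: (@filter_forall R I (fun i s => phi i s < 0) (nbhs tau) _) => i.
    have hi : phi i tau < 0 by rewrite ltNge; apply/negP/hN.
    exact: (cvgr_lt (phi i tau) (cphi i tau) _ hi).
  have [e /= e0 he] := near_neg.
  have [s [s0 [i phis]] hs] := inf_adherent e0 hB.
  have sle : tau <= s by apply: ge_inf; [exists 0 | split => //; exists i].
  have : phi i s < 0.
    by apply: he; rewrite /ball /= ltr_distlC; apply/andP; split; lra.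
  by rewrite ltNge phis.
have tau_gt0 : 0 < tau.
  rewrite lt_def tau_ge0 andbT; apply/eqP => tau0.
  by move: phi1; rewrite tau0 leNgt phi0.
have left_neg i : \forall s \near tau^'-, phi i s < 0.
  apply: filterS2 (nbhs_left_ge tau_gt0) (nbhs_left_lt tau) => s s0 st.
  exact: before.
have at_tau j : phi j tau <= 0.
  rewrite leNgt; apply/negP => hj.
  have pos : \forall s \near tau^'-, 0 < phi j s.
    by apply: (cvgr_gt (phi j tau)) => //; apply: cvg_at_left_filter; exact: cphi.
  have [s [h1 h2]] : exists s, phi j s < 0 /\ 0 < phi j s.
    exact: (@filter_ex R tau^'- _ _ (filterI (left_neg j) pos)).
  by move: (lt_trans h1 h2); rewrite ltxx.
have phi1_0 : phi i1 tau = 0 by apply/eqP; rewrite eq_le at_tau.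
(* Write [phi i1 s = g s * (s - tau)] with [g] continuous at [tau] and [g tau = d < 0]: just left of
   [tau] both factors are negative, so [phi i1 s > 0]. *)
have [d d0 /is_derive1_caratheodory[g [eg cg gd]]] := dphi _ _ tau_gt0 at_tau phi1_0.
have gneg : \forall s \near tau^'-, g s < 0.
  by apply: (cvgr_lt (g tau)); rewrite ?gd // -gd; apply: cvg_at_left_filter; exact: cg.
have stau : \forall s \near tau^'-, s < tau by exact: nbhs_left_lt.
have [s [h1 [h2 h3]]] : exists s, phi i1 s < 0 /\ g s < 0 /\ s < tau.
  exact: (@filter_ex R tau^'- _ _ (filterI (left_neg i1) (filterI gneg stau))).
have := eg s; rewrite phi1_0 subr0 => es.
have : 0 < phi i1 s by rewrite es nmulr_rgt0 // subr_lt0.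
by move=> /(lt_trans h1); rewrite ltxx.
Qed.

Lemma is_derive_expRNM (c t : R) :
  is_derive t (1 : R) (fun s => expR (- (c * s))) (expR (- (c * t)) * - c).
Proof.
apply: (@is_derive1_comp R expR (fun s => - (c * s))).
have -> : (fun s => - (c * s)) = (- c) \*: id.
  by apply/funext => s /=; rewrite /GRing.scale /= mulNr.
by apply: is_derive_eq; rewrite /GRing.scale /= mulr1.
Qed.

(** On [[0, T]] the coefficient [k] is at most its maximum [k c], so [exp (- k c t) q t] is
    nonincreasing; it starts at [0]. *)
Lemma gronwall_zero (q k : R -> R) :
  continuous q -> continuous k -> q 0 = 0 -> (forall t, 0 <= q t) ->
  (forall t, 0 < t -> exists2 d, d <= k t * q t & is_derive t 1 q d) ->
  forall t, 0 <= t -> q t = 0.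
Proof.
move=> cq ck q0 qge0 dq T T0.
have [c _ hc] := EVT_max T0 (continuous_subspaceT ck).
pose psi t := expR (- (k c * t)) * q t.
have dpsi t : 0 < t -> t < T -> exists2 d, d <= 0 & is_derive t 1 psi d.
  move=> t0 tT; have [d hd dqt] := dq t t0.
  exists (expR (- (k c * t)) * d + q t * (expR (- (k c * t)) * - k c)); last first.
    exact: (is_deriveM (is_derive_expRNM (k c) t) dqt).
  have ktc : k t <= k c by apply: hc; rewrite in_itv /= !ltW.
  have : d <= k c * q t by apply: le_trans hd _; exact: ler_wpM2r.
  have := expR_gt0 (- (k c * t)); move: (expR _) => e e0 h.
  rewrite [leLHS](_ : _ = e * (d - k c * q t)); last by ring.
  by rewrite pmulr_rle0 // subr_le0.
have cpsi : continuous psi.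
  move=> t; apply: cvgM; last exact: cq.
  apply: (@continuous_comp _ _ _ (fun s => - (k c * s)) expR); last exact: continuous_expR.
  by apply: cvgN; apply: cvgM; [exact: cvg_cst | exact: cvg_id].
have psi_le : psi T <= psi 0.
  apply: (@ler0_derive1_le_cc R psi 0 T) => //.
  - by move=> x; rewrite in_itv /= => /andP[x0 xT]; have [d _ []] := dpsi x x0 xT.
  - move=> x; rewrite in_itv /= => /andP[x0 xT].
    by have [d d0 [_ e]] := dpsi x x0 xT; rewrite derive1E e.
  - exact: (continuous_subspaceT cpsi).
  - by rewrite in_itv /= ?lexx ?T0.
  - by rewrite in_itv /= ?lexx ?T0.
move: psi_le; rewrite /psi q0 mulr0 pmulr_rle0 ?expR_gt0 // => qT.
by apply/eqP; rewrite eq_le qT qge0.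
Qed.

Lemma is_derive_mxP (p q : nat) (A : R -> 'M[R]_(p, q)) (t : R) (dA : 'M[R]_(p, q)) :
  is_derive t 1 A dA <-> forall i j, is_derive t 1 (fun s => A s i j) (dA i j).
Proof.
split=> [[dA1 <-] i j|h].
  apply: DeriveDef; first exact: ((derivable_mxP A t 1).1 dA1).
  by rewrite derive_mx // mxE.
have dA1 : derivable A t 1 by apply/derivable_mxP => i j; have [] := h i j.
apply: DeriveDef => //; rewrite derive_mx //.
by apply/matrixP => i j; rewrite mxE; have [] := h i j.
Qed.

Lemma is_derive_sum_fun (N : nat) (f : 'I_N -> R -> R) (df : 'I_N -> R) (t : R) :
  (forall i, is_derive t 1 (f i) (df i)) ->
  is_derive t 1 (fun s => \sum_i f i s) (\sum_i df i).
Proof. by move=> h; rewrite -fct_sumE; exact: is_derive_sum. Qed.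

Lemma is_derive_mul_fun (f g : R -> R) (df dg t : R) :
  is_derive t 1 f df -> is_derive t 1 g dg ->
  is_derive t 1 (fun s => f s * g s) (df * g t + f t * dg).
Proof.
move=> hf hg; apply: is_derive_eq (is_deriveM hf hg) _.
by rewrite /GRing.scale /=; ring.
Qed.

Lemma is_derive_mulmx (p q r : nat) (A : R -> 'M[R]_(p, q)) (B : R -> 'M[R]_(q, r))
    (t : R) dA dB :
  is_derive t 1 A dA -> is_derive t 1 B dB ->
  is_derive t 1 (fun s => A s *m B s) (dA *m B t + A t *m dB).
Proof.
move=> /is_derive_mxP hA /is_derive_mxP hB; apply/is_derive_mxP => i j.
rewrite !mxE -big_split.
under [X in is_derive _ _ X _]eq_fun do rewrite mxE.
by apply: is_derive_sum_fun => k; exact: is_derive_mul_fun.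
Qed.

Lemma is_derive_trmx (p q : nat) (A : R -> 'M[R]_(p, q)) (t : R) dA :
  is_derive t 1 A dA -> is_derive t 1 (fun s => (A s)^T) dA^T.
Proof.
move=> /is_derive_mxP hA; apply/is_derive_mxP => i j.
by rewrite mxE; under [X in is_derive _ _ X _]eq_fun do rewrite mxE.
Qed.

Lemma is_derive_frob_inner (p q : nat) (A B : R -> 'M[R]_(p, q)) (t : R) dA dB :
  is_derive t 1 A dA -> is_derive t 1 B dB ->
  is_derive t 1 (fun s => frob_inner (A s) (B s))
    (frob_inner dA (B t) + frob_inner (A t) dB).
Proof.
move=> /is_derive_mxP hA /is_derive_mxP hB.
rewrite !frob_innerE -big_split.
under [X in is_derive _ _ X _]eq_fun do rewrite frob_innerE.
apply: is_derive_sum_fun => i; rewrite -big_split.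
by apply: is_derive_sum_fun => j; exact: is_derive_mul_fun.
Qed.

(** Working with entries reduces products and inner products to finite sums of real functions. *)
Definition entrywise_continuous (p q : nat) (A : R -> 'M[R]_(p, q)) :=
  forall i j, continuous (fun s => A s i j).

Lemma continuous_entries (p q : nat) (A : R -> 'M[R]_(p, q)) :
  continuous A -> entrywise_continuous A.
Proof.
move=> cA i j t.
apply: (@continuous_comp _ _ _ A (fun M : 'M[R]_(p, q) => M i j)); first exact: cA.
exact: coord_continuous.
Qed.

Lemma continuous_sum_fun (N : nat) (f : 'I_N -> R -> R) :
  (forall i, continuous (f i)) -> continuous (fun s => \sum_i f i s).
Proof. by move=> h; apply: continuous_big => //; exact: add_continuous. Qed.

Lemma entrywise_continuous_mulmx (p q r : nat) (A : R -> 'M[R]_(p, q))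
    (B : R -> 'M[R]_(q, r)) :
  entrywise_continuous A -> entrywise_continuous B ->
  entrywise_continuous (fun s => A s *m B s).
Proof.
move=> hA hB i j; under eq_fun do rewrite mxE.
by apply: continuous_sum_fun => k t; apply: cvgM; [exact: hA | exact: hB].
Qed.

Lemma entrywise_continuous_trmx (p q : nat) (A : R -> 'M[R]_(p, q)) :
  entrywise_continuous A -> entrywise_continuous (fun s => (A s)^T).
Proof. by move=> hA i j; under eq_fun do rewrite mxE; exact: hA. Qed.

Lemma entrywise_continuousB (p q : nat) (A B : R -> 'M[R]_(p, q)) :
  entrywise_continuous A -> entrywise_continuous B ->
  entrywise_continuous (fun s => A s - B s).
Proof.
move=> hA hB i j; under eq_fun do rewrite !mxE.
by move=> t; apply: cvgB; [exact: hA | exact: hB].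
Qed.

Lemma continuous_frob_inner (p q : nat) (A B : R -> 'M[R]_(p, q)) :
  entrywise_continuous A -> entrywise_continuous B ->
  continuous (fun s => frob_inner (A s) (B s)).
Proof.
move=> hA hB; under eq_fun do rewrite frob_innerE.
apply: continuous_sum_fun => i; apply: continuous_sum_fun => j t.
by apply: cvgM; [exact: hA | exact: hB].
Qed.

End Calculus.

(** * Invariance of orthogonality and exponential decay of pairwise distances *)

Section Dynamics.
Variable R : realType.

Lemma frob_inner_young (p q : nat) (A B : 'M[R]_(p, q)) :
  - (2 * frob_inner A B) <= frob_inner A A + frob_inner B B.
Proof.
have := frob_inner_ge0 (A + B).
rewrite !(frob_innerDl, frob_innerDr) (frob_innerC B A); lra.
Qed.

(* [E = U^T U - 1] solves the linear equation [E' = - (P^T E + E P)], where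
   [P = W^T U]. *)
Lemma orthogonality_preserved (n : nat) (U W : R -> 'M[R]_n) :
  entrywise_continuous U -> entrywise_continuous W ->
  (forall t : R, 0 < t -> is_derive t 1 U (W t - U t *m (W t)^T *m U t)) ->
  (U 0)^T *m U 0 = 1%:M -> forall t, 0 <= t -> (U t)^T *m U t = 1%:M.
Proof.
move=> cU cW dU U0 t t0.
pose E s := (U s)^T *m U s - 1%:M; pose P s := (W s)^T *m U s.
(* The derivative of [q] is [- 2 <E, P^T E> - 2 <E, E P>]. Young's inequality and
   submultiplicativity bound each term by [(1 + |P|^2) |E|^2], hence this [k]. *)
pose q s := frob_inner (E s) (E s); pose k s := 2 * (1 + frob_inner (P s) (P s)).
suff : q t = 0 by move=> /frob_inner_eq0 /subr0_eq.
have cP : entrywise_continuous P.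
  by apply: entrywise_continuous_mulmx => //; exact: entrywise_continuous_trmx.
have cE : entrywise_continuous E.
  apply: entrywise_continuousB; last by move=> i j s; exact: cvg_cst.
  by apply: entrywise_continuous_mulmx => //; exact: entrywise_continuous_trmx.
apply: (@gronwall_zero R q k) => //.
- exact: continuous_frob_inner.
- move=> s; apply: cvgM; first exact: cvg_cst.
  by apply: cvgD; [exact: cvg_cst | exact: continuous_frob_inner].
- by rewrite /q /E U0 subrr -(scale0r (0 : 'M[R]_n)) frob_innerZl mul0r.
- by move=> s; exact: frob_inner_ge0.
move=> s s0; have dUs := dU s s0.
have dE : is_derive s 1 E (- ((P s)^T *m E s + E s *m P s)).
  have h := is_deriveB (is_derive_mulmx (is_derive_trmx dUs) dUs)
                       (is_derive_cst (1%:M : 'M[R]_n) s 1).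
  apply: is_derive_eq h _.
  rewrite subr0 /E /P linearB /= !trmx_mul !trmxK.
  rewrite mulmxBl !mulmxBr mulmxBl !mulmxA mulmx1 mul1mx.
  by apply/matrixP => i j; rewrite !mxE; ring.
exists (frob_inner (- ((P s)^T *m E s + E s *m P s)) (E s) +
        frob_inner (E s) (- ((P s)^T *m E s + E s *m P s))); last first.
  exact: is_derive_frob_inner.
rewrite (frob_innerC _ (E s)) frob_innerNr frob_innerDr /k /q.
have h1 := frob_inner_young (E s) ((P s)^T *m E s).
have h2 := frob_inner_young (E s) (E s *m P s).
have h3 := frob_inner_mulmx_le (P s)^T (E s).
have h4 := frob_inner_mulmx_le (E s) (P s).
rewrite frob_inner_tr in h3.
lra.
Qed.

(** The curve [W] of [orthogonality_preserved]: [W - U W^T U] is linear in [W], so the weighted sum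
    over [k] can be formed first. *)
Definition mean_field (N n m : nat) (kappa : R) (U : 'I_N -> 'M[R]_n)
    (V : 'I_N -> 'M[R]_m) (j : 'I_N) : 'M[R]_n :=
  (kappa / N%:R) *: \sum_(k < N) frob_inner (V j) (V k) *: U k.

Lemma dsom_rhs_mean_field (N n m : nat) (kappa : R) (U : 'I_N -> 'M[R]_n)
    (V : 'I_N -> 'M[R]_m) (j : 'I_N) :
  dsom_rhs kappa U V j =
  mean_field kappa U V j - U j *m (mean_field kappa U V j)^T *m U j.
Proof.
rewrite /dsom_rhs /mean_field linearZ /= -scalemxAr -scalemxAl -scalerBr.
congr (_ *: _); rewrite linear_sum /= mulmx_sumr mulmx_suml -sumrB.
apply: eq_bigr => k _.
by rewrite linearZ /= -scalemxAr -scalemxAl -scalerBr.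
Qed.

Lemma frob_inner_dsom_rhs (N n m : nat) (kappa : R) (U : 'I_N -> 'M[R]_n)
    (V : 'I_N -> 'M[R]_m) (j : 'I_N) (Y : 'M[R]_n) :
  frob_inner (dsom_rhs kappa U V j) Y =
  kappa / N%:R * \sum_(k < N) frob_inner (V j) (V k) * alignment (U j) Y (U k).
Proof.
rewrite /dsom_rhs frob_innerZl frob_inner_suml; congr (_ * _).
by apply: eq_bigr => k _; rewrite frob_innerZl.
Qed.

(** Every [k] contributes at least [x^2] by [weighted_alignment_lower], whose weights come from [V];
    averaging over [k] leaves the factor [kappa]. *)
Lemma extremal_pair_decay (N n m : nat) (kappa x : R) (U : 'I_N -> 'M[R]_n)
    (V : 'I_N -> 'M[R]_m) (i j : 'I_N) :
  (0 < m)%N -> 0 < kappa -> 0 <= x -> x <= 1 / 4 ->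
  (forall a, (U a)^T *m U a = 1%:M) -> (forall a, (V a)^T *m V a = 1%:M) ->
  (forall a b, 2 * (n%:R - frob_inner (U a) (U b)) <= x ^+ 2) ->
  (forall a b, 2 * (m%:R - frob_inner (V a) (V b)) <= x ^+ 2) ->
  2 * (n%:R - frob_inner (U i) (U j)) = x ^+ 2 ->
  kappa * x ^+ 2 <= frob_inner (dsom_rhs kappa U V i) (U j) +
                    frob_inner (U i) (dsom_rhs kappa U V j).
Proof.
move=> m0 k0 x0 x4 oU oV hU hV hij.
rewrite (frob_innerC (U i)) !frob_inner_dsom_rhs -mulrDr -big_split /=.
have N0 : 0 < N%:R :> R by rewrite ltr0n; apply: leq_ltn_trans (ltn_ord i).
have -> : kappa * x ^+ 2 = kappa / N%:R * (N%:R * x ^+ 2).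
  by rewrite mulrA divfK // lt0r_neq0.
apply: ler_wpM2l; first by rewrite divr_ge0 // ltW.
have -> : N%:R * x ^+ 2 = \sum_(k < N) x ^+ 2.
  by rewrite sumr_const card_ord mulr_natl.
apply: ler_sum => k _.
have gap a : 0 <= 2 * (m%:R - frob_inner (V a) (V k)) <= x ^+ 2.
  by rewrite hV andbT -frob_dist_ortho //; exact: frob_inner_ge0.
apply: (@weighted_alignment_lower R n _ _ _ x m%:R) => //.
- by rewrite ler1n.
- by rewrite frob_dist_ortho.
- by rewrite frob_dist_ortho.
- by rewrite frob_dist_ortho.
Qed.

(** For orthogonal matrices this is the squared distance [|W_i - W_j|^2], by [frob_dist_ortho]. *)
Definition gap (N p : nat) (W : 'I_N -> R -> 'M[R]_p) (ij : 'I_N * 'I_N) (t : R) : R :=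
  2 * (p%:R - frob_inner (W ij.1 t) (W ij.2 t)).

(** It starts at [(1/4)^2], matching the radius allowed in [extremal_pair_decay], and decays at
    [kappa], half the rate [2 kappa] available for an extremal gap. *)
Definition barrier_rate (kappa t : R) : R := expR (- (kappa * t)) / 16.

Lemma is_derive_barrier_rate (kappa t : R) :
  is_derive t 1 (barrier_rate kappa) (- kappa * barrier_rate kappa t).
Proof.
have de := is_derive_expRNM kappa t.
apply: is_derive_eq (is_derive_mul_fun de (is_derive_cst (16^-1 : R) t 1)) _.
by rewrite /barrier_rate /=; ring.
Qed.

Lemma continuous_gap (N p : nat) (W : 'I_N -> R -> 'M[R]_p) ij :
  (forall j, continuous (W j)) -> continuous (gap W ij).
Proof.
move=> cW t; apply: cvgM; first exact: cvg_cst.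
apply: cvgB; first exact: cvg_cst.
by apply: continuous_frob_inner; exact: continuous_entries.
Qed.

Lemma is_derive_gap (N p : nat) (W : 'I_N -> R -> 'M[R]_p) ij (t : R) dW :
  (forall j, is_derive t 1 (W j) (dW j)) ->
  is_derive t 1 (gap W ij)
    (- (2 * (frob_inner (dW ij.1) (W ij.2 t) + frob_inner (W ij.1 t) (dW ij.2)))).
Proof.
move=> hW; have h := is_derive_frob_inner (hW ij.1) (hW ij.2).
have h' := is_deriveB (is_derive_cst (p%:R : R) t 1) h.
apply: is_derive_eq (is_derive_mul_fun (is_derive_cst (2 : R) t 1) h') _.
by rewrite /cst; ring.
Qed.

(** One half of the system; exchanging [U] and [V] gives the other half. *)
Definition global_flow (N n m : nat) (kappa : R) (U : 'I_N -> R -> 'M[R]_n)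
    (V : 'I_N -> R -> 'M[R]_m) : Prop :=
  (forall j, continuous (U j)) /\
  (forall j (t : R), 0 < t ->
     is_derive t 1 (U j) (dsom_rhs kappa (fun k => U k t) (fun k => V k t) j)).

Lemma flow_orthogonal (N n m : nat) (kappa : R) (U : 'I_N -> R -> 'M[R]_n)
    (V : 'I_N -> R -> 'M[R]_m) :
  global_flow kappa U V -> (forall j, continuous (V j)) ->
  (forall j, (U j 0)^T *m U j 0 = 1%:M) ->
  forall j t, 0 <= t -> (U j t)^T *m U j t = 1%:M.
Proof.
move=> [cU dU] cV U0 j.
apply: (@orthogonality_preserved n (U j)
  (fun t => mean_field kappa (fun k => U k t) (fun k => V k t) j)) => //.
- exact: continuous_entries.
- move=> a b; under eq_fun do rewrite mxE summxE.
  move=> t; apply: cvgM; first exact: cvg_cst.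
  apply: continuous_sum_fun => k s; under eq_fun do rewrite mxE.
  apply: cvgM; last exact: continuous_entries.
  by apply: continuous_frob_inner; exact: continuous_entries.
- by move=> t t0; rewrite -dsom_rhs_mean_field; exact: dU.
Qed.

(** With [x^2 = r], the gap has derivative at most [- 2 kappa r] and the barrier exactly
    [- kappa r], so the difference falls at rate at least [kappa r]. *)
Lemma gap_crossing (N n m : nat) (kappa t : R) (U : 'I_N -> R -> 'M[R]_n)
    (V : 'I_N -> R -> 'M[R]_m) ij :
  (0 < m)%N -> 0 < kappa -> 0 < t -> global_flow kappa U V ->
  (forall a, (U a t)^T *m U a t = 1%:M) -> (forall a, (V a t)^T *m V a t = 1%:M) ->
  (forall ab, gap U ab t <= barrier_rate kappa t) ->
  (forall ab, gap V ab t <= barrier_rate kappa t) ->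
  gap U ij t = barrier_rate kappa t ->
  exists2 d, d < 0 &
    is_derive t 1 (fun s => gap U ij s - barrier_rate kappa s) d.
Proof.
move=> m0 k0 t0 [_ dU] oU oV hU hV hij.
set r := barrier_rate kappa t in hU hV hij.
have r0 : 0 < r by rewrite divr_gt0 // expR_gt0.
have r1 : r <= 1 / 16.
  by rewrite ler_wpM2r // expR_le1 oppr_le0 mulr_ge0 // ltW.
have er : Num.sqrt r ^+ 2 = r by rewrite sqr_sqrtr // ltW.
have x4 : Num.sqrt r <= 1 / 4.
  rewrite -ler_sqr ?nnegrE ?sqrtr_ge0 ?divr_ge0 // er.
  by apply: le_trans r1 _; rewrite expr2; lra.
have dgap := is_derive_gap ij (fun j => dU j t t0).
have := is_deriveB dgap (is_derive_barrier_rate kappa t).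
set d := (X in is_derive _ _ _ X); exists d => //.
have := @extremal_pair_decay N n m kappa (Num.sqrt r) (fun a => U a t)
  (fun a => V a t) ij.1 ij.2 m0 k0 (sqrtr_ge0 r) x4 oU oV.
rewrite er => /(_ (fun a b => hU (a, b)) (fun a b => hV (a, b)) hij).
rewrite /d -/r; have := mulr_gt0 k0 r0; lra.
Qed.

Lemma gap_decay (N n m : nat) (kappa : R) (U : 'I_N -> R -> 'M[R]_n)
    (V : 'I_N -> R -> 'M[R]_m) :
  (0 < n)%N -> (0 < m)%N -> 0 < kappa ->
  global_flow kappa U V -> global_flow kappa V U ->
  (forall j, (U j 0)^T *m U j 0 = 1%:M) -> (forall j, (V j 0)^T *m V j 0 = 1%:M) ->
  (forall ij, gap U ij 0 < 1 / 16) -> (forall ij, gap V ij 0 < 1 / 16) ->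
  forall t, 0 <= t -> forall ij,
    gap U ij t < barrier_rate kappa t /\ gap V ij t < barrier_rate kappa t.
Proof.
move=> n0 m0 k0 fU fV oU0 oV0 hU0 hV0 t t0 ij.
have oU := flow_orthogonal fU fV.1 oU0; have oV := flow_orthogonal fV fU.1 oV0.
(* Both kinds of gap form one family, because a crossing in either factor is excluded using the
   bounds on both. *)
pose phi (a : 'I_N * 'I_N + 'I_N * 'I_N) s :=
  match a with inl ij => gap U ij s | inr ij => gap V ij s end - barrier_rate kappa s.
suff h a : phi a t < 0.
  by have := h (inl ij); have := h (inr ij); rewrite /phi !subr_lt0.
move: t t0 a; apply: barrier => [a s|a|a t t0 le0 eq0].
- apply: cvgB; first by case: a => ab; apply: continuous_gap; [case: fU|case: fV].
  apply/differentiable_continuous/derivable1_diffP.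
  by have [] := is_derive_barrier_rate kappa s.
- rewrite /phi subr_lt0 /barrier_rate mulr0 oppr0 expR0.
  by case: a.
have leU ab : gap U ab t <= barrier_rate kappa t.
  by have := le0 (inl ab); rewrite /phi subr_le0.
have leV ab : gap V ab t <= barrier_rate kappa t.
  by have := le0 (inr ab); rewrite /phi subr_le0.
have oUt a' := oU a' t (ltW t0); have oVt a' := oV a' t (ltW t0).
case: a eq0 => ab /subr0_eq eq0.
  exact: gap_crossing fU _ _ _ _ _.
exact: gap_crossing fV _ _ _ _ _.
Qed.

End Dynamics.

(** * Extension to the whole line, the initial threshold, and convergence of [dsomL] *)

Section Synchronization.
Variable R : realType.

(* Extends a solution by a constant to negative times, which makes it continuous
   on the whole line. *)
Definition freeze (T : Type) (f : R -> T) (t : R) : T := f (Num.max t 0).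

Lemma freezeE (T : Type) (f : R -> T) (t : R) : 0 <= t -> freeze f t = f t.
Proof. by move=> t0; rewrite /freeze max_l. Qed.

Lemma continuous_freeze (T : topologicalType) (f : R -> T) :
  (forall t : R, 0 < t -> {for t, continuous f}) ->
  f s @[s --> 0^'+] --> f 0 -> continuous (freeze f).
Proof.
move=> cf cf0 t; have [t0|t0] := ltP 0 t.
  change {for t, continuous (f \o (fun s : R => Num.max s 0))}.
  apply: continuous_comp.
    by apply: (@continuous_max R R^o); [exact: cvg_id | exact: cvg_cst].
  by rewrite max_l; [exact: cf | exact: ltW].
have e0 : freeze f t = f 0 by rewrite /freeze max_r.
rewrite /continuous_at e0 => A A0.
have [e /= e_gt0 he] := cf0 A A0.
(* For [t <= 0], a point [s] within [e] of [t] is either nonpositive, where the value is [f 0], or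
   in [(0, e)], where the right limit applies. *)
exists e => // s /=; rewrite ltr_distlC => /andP[_ hs].
rewrite /freeze; have [s0|s0] := leP s 0; first exact: nbhs_singleton.
apply: he => //=; rewrite sub0r normrN gtr0_norm //; lra.
Qed.

Lemma global_flow_freeze (N n m : nat) (kappa : R) (U : 'I_N -> R -> 'M[R]_n)
    (V : 'I_N -> R -> 'M[R]_m) :
  (forall j (t : R), 0 < t ->
     is_derive t 1 (U j) (dsom_rhs kappa (fun k => U k t) (fun k => V k t) j)) ->
  (forall j, U j s @[s --> 0^'+] --> U j 0) ->
  global_flow kappa (fun j => freeze (U j)) (fun j => freeze (V j)).
Proof.
move=> dU cU; split=> [j|j t t0].
  apply: continuous_freeze => // t t0.
  by apply/differentiable_continuous/derivable1_diffP; have [] := dU j t t0.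
apply: (@near_eq_is_derive _ _ _ (U j)); last first.
  under eq_fun do rewrite freezeE ?ltW //.
  by under [X in dsom_rhs _ _ X]eq_fun do rewrite freezeE ?ltW //; exact: dU.
have : \forall s \near t, 0 < s by exact: lt_nbhsr.
by apply: filterS => s s0; rewrite freezeE // ltW.
Qed.

Lemma alpha_mn_le (n m : nat) : (m <= n)%N -> alpha_mn R n m <= 1 / 4.
Proof.
move=> mn; rewrite /alpha_mn.
have n0 : 0 <= n%:R :> R by exact: ler0n.
have m0 : 0 <= m%:R :> R by exact: ler0n.
have mnR : m%:R <= n%:R :> R by rewrite ler_nat.
rewrite ler_pdivrMr; last by lra.
(* Clearing the denominator gives [(12 n + 27) + (4 n + 3) = 16 n + 30]; after squaring, [m <= n]
   suffices. *)
suff : Num.sqrt ((12 * n%:R + 27) ^+ 2 + 24 * m%:R * (3 * n%:R + 4)) <=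
    16 * n%:R + 30 :> R by lra.
rewrite -[leRHS]ger0_norm; last by lra.
rewrite -sqrtr_sqr ler_wsqrtr // !expr2; nra.
Qed.

Lemma diam_ge (N p : nat) (W : 'I_N -> 'M[R]_p) (i j : 'I_N) :
  frob_norm (W i - W j) <= diam W.
Proof.
apply: le_trans (le_bigmax _ (fun i => \big[Num.max/0]_j frob_norm (W i - W j)) i).
exact: (le_bigmax _ (fun j => frob_norm (W i - W j)) j).
Qed.

Lemma diam_le (N p : nat) (W : 'I_N -> 'M[R]_p) (x : R) : 0 <= x ->
  (forall i j, frob_norm (W i - W j) <= x) -> diam W <= x.
Proof.
by move=> x0 h; apply: bigmax_le => // i _; apply: bigmax_le => // j _.
Qed.

Lemma devS_le (N p : nat) (W : 'I_N -> 'M[R]_p) (x : R) : 0 <= x ->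
  (forall i j, `|p%:R - frob_inner (W i) (W j)| <= x) -> devS W <= x.
Proof.
by move=> x0 h; apply: bigmax_le => // i _; apply: bigmax_le => // j _.
Qed.

Lemma diam_ge0 (N p : nat) (W : 'I_N -> 'M[R]_p) : 0 <= diam W.
Proof. exact: bigmax_ge_id. Qed.

Lemma devS_ge0 (N p : nat) (W : 'I_N -> 'M[R]_p) : 0 <= devS W.
Proof. exact: bigmax_ge_id. Qed.

Lemma dsomL_ge0 (N n m : nat) (U : 'I_N -> R -> 'M[R]_n)
    (V : 'I_N -> R -> 'M[R]_m) (t : R) : 0 <= dsomL U V t.
Proof. by rewrite !addr_ge0 ?diam_ge0 ?devS_ge0. Qed.

Lemma gap_lt_of_diam (N p : nat) (W : 'I_N -> R -> 'M[R]_p) ij :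
  (forall j, (W j 0)^T *m W j 0 = 1%:M) ->
  diam (fun k => W k 0) < 1 / 4 -> gap W ij 0 < 1 / 16.
Proof.
move=> oW hd; rewrite /gap -frob_dist_ortho //.
have := le_lt_trans (diam_ge (fun k => W k 0) ij.1 ij.2) hd.
have := sqrtr_ge0 (frob_inner (W ij.1 0 - W ij.2 0) (W ij.1 0 - W ij.2 0)).
rewrite /frob_norm -{3}[frob_inner _ _]sqr_sqrtr ?frob_inner_ge0 //.
by move: (Num.sqrt _) => x x0 x4; rewrite expr2; nra.
Qed.

(** A distance is the square root of its gap, and a deviation is half of its gap. *)
Lemma diam_devS_le_of_gap (N p : nat) (W : 'I_N -> R -> 'M[R]_p) (t r : R) :
  0 <= r -> (forall j, (W j t)^T *m W j t = 1%:M) ->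
  (forall ij, gap W ij t <= r) ->
  diam (fun k => W k t) <= Num.sqrt r /\ devS (fun k => W k t) <= r.
Proof.
move=> r0 oW h; split.
  apply: diam_le => [|i j]; first exact: sqrtr_ge0.
  by rewrite /frob_norm ler_wsqrtr // frob_dist_ortho //; exact: (h (i, j)).
apply: devS_le => // i j; have := h (i, j).
have := frob_inner_ge0 (W i t - W j t); rewrite frob_dist_ortho // /gap /=.
by move=> h1 h2; rewrite ger0_norm; lra.
Qed.

Lemma barrier_rate_cvg0 (kappa : R) : 0 < kappa ->
  barrier_rate kappa t @[t --> +oo] --> 0.
Proof.
move=> k0; rewrite -(mul0r (16^-1 : R)); apply: cvgM; last exact: cvg_cst.
apply: (@cvg_comp _ _ _ (fun t => kappa * t) (fun x => expR (- x)) _ +oo).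
  by apply: gt0_cvgMry => //; exact: cvg_id.
exact: cvgr_expR.
Qed.

End Synchronization.

Theorem theoremC1 (R : realType) (N n m : nat) (kappa : R)
  (U : 'I_N -> R -> 'M[R]_n) (V : 'I_N -> R -> 'M[R]_m) :
  (1 <= N)%N -> (0 < m)%N -> (m <= n)%N -> 0 < kappa ->
  is_dsom_solution kappa U V ->
  (forall j, is_SO (U j 0) /\ is_SO (V j 0)) ->
  dsomL U V 0 < alpha_mn R n m ->
  dsomL U V t @[t --> +oo] --> 0.
Proof.
move=> _ m0 mn k0 [dUV cUV] so0 L0.
pose Uf j := freeze (U j); pose Vf j := freeze (V j).
have fU : global_flow kappa Uf Vf.
  by apply: global_flow_freeze => [j t t0|j]; [case: (dUV j t t0) | case: (cUV j)].
have fV : global_flow kappa Vf Uf.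
  by apply: global_flow_freeze => [j t t0|j]; [case: (dUV j t t0) | case: (cUV j)].
have oU0 j : (Uf j 0)^T *m Uf j 0 = 1%:M by rewrite /Uf freezeE //; case: (so0 j) => -[].
have oV0 j : (Vf j 0)^T *m Vf j 0 = 1%:M by rewrite /Vf freezeE //; case: (so0 j) => _ [].
have {L0} : dsomL U V 0 < 1 / 4 by apply: lt_le_trans L0 _; exact: alpha_mn_le.
rewrite /dsomL => L0.
(* All four summands are nonnegative, so each initial diameter is below [1/4]. *)
have dU := diam_ge0 (fun k => U k 0); have dV := diam_ge0 (fun k => V k 0).
have sU := devS_ge0 (fun k => U k 0); have sV := devS_ge0 (fun k => V k 0).
have gU ij : gap Uf ij 0 < 1 / 16.
  apply: gap_lt_of_diam => //; rewrite (_ : (fun k => Uf k 0) = (fun k => U k 0)).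
    by lra.
  by apply/funext => k; exact: freezeE.
have gV ij : gap Vf ij 0 < 1 / 16.
  apply: gap_lt_of_diam => //; rewrite (_ : (fun k => Vf k 0) = (fun k => V k 0)).
    by lra.
  by apply/funext => k; exact: freezeE.
have n0 : (0 < n)%N by apply: leq_trans mn.
have decay := gap_decay n0 m0 k0 fU fV oU0 oV0 gU gV.
have oU := flow_orthogonal fU fV.1 oU0; have oV := flow_orthogonal fV fU.1 oV0.
pose r t := barrier_rate kappa t.
have bound t : 0 <= t -> dsomL U V t <= (Num.sqrt (r t) + Num.sqrt (r t)) + (r t + r t).
  move=> t0; have r0 : 0 <= r t by rewrite divr_ge0 // expR_ge0.
  have [|||hdU hsU] := @diam_devS_le_of_gap R N n Uf t (r t).
  - by [].
  - by move=> j; exact: oU.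
  - by move=> ij; apply: ltW; have [] := decay t t0 ij.
  have [|||hdV hsV] := @diam_devS_le_of_gap R N m Vf t (r t).
  - by [].
  - by move=> j; exact: oV.
  - by move=> ij; apply: ltW; have [] := decay t t0 ij.
  have eU : (fun k => Uf k t) = (fun k => U k t) by apply/funext => k; exact: freezeE.
  have eV : (fun k => Vf k t) = (fun k => V k t) by apply/funext => k; exact: freezeE.
  by rewrite eU in hdU hsU; rewrite eV in hdV hsV; rewrite /dsomL; lra.
have r_cvg : r t @[t --> +oo] --> (0 : R) by exact: barrier_rate_cvg0.
have sr_cvg : Num.sqrt (r t) @[t --> +oo] --> (0 : R).
  rewrite -[X in _ --> X](sqrtr0 R).
  by apply: continuous_cvg => //; exact: sqrt_continuous.
(* [dsomL] lies between [0] and a bound that vanishes with [r]. *)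
apply: (@squeeze_cvgr _ _ _ _ (fun=> 0)
  (fun t => (Num.sqrt (r t) + Num.sqrt (r t)) + (r t + r t))).
- near=> t; rewrite dsomL_ge0 /=; apply: bound.
  by near: t; apply: nbhs_pinfty_ge; exact: num_real.
- exact: cvg_cst.
- by rewrite -[X in _ --> X](addr0 (0 : R)) -[X in _ --> X + X](addr0 (0 : R));
    do 2?[apply: cvgD].
Unshelve. all: by end_near. Qed.
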